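(* Let $n\ge1$, $X\in L^\infty$ and $h_1,\dots,h_n\in\mathcal H^{\rm BV}$ with $h_i(1)=0$ for all $i\in[n]$. For an allocation $(X_1,\dots,X_n)\in\mathbb A_n^+(X)$, it holds that (i)$\Rightarrow$(ii)$\Rightarrow$(iii): (i) $\sum_{i=1}^n\lambda_i\rho_{h_i}(X_i)=\mathop{\boxplus}_{i=1}^n(\lambda_i\rho_{h_i})(X)$ for some $(\lambda_1,\dots,\lambda_n)\in(0,\infty)^n$; (ii) $(X_1,\dots,X_n)$ is Pareto optimal in $\mathbb A_n^+(X)$; (iii) $\sum_{i=1}^n\lambda_i\rho_{h_i}(X_i)=\mathop{\boxplus}_{i=1}^n(\lambda_i\rho_{h_i})(X)$ for some $(\lambda_1,\dots,\lambda_n)\in[0,\infty)^n\setminus\{\mathbf 0\}$.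
   Context: $(\Omega,\mathcal F,\mathbb P)$ is an atomless probability space; a.s. equal random variables are identified; $L^\infty$ is the set of essentially bounded random variables; $[n]=\{1,\dots,n\}$. $\mathcal H^{\rm BV}$ is the set of functions $h:[0,1]\to\mathbb R$ of bounded variation with $h(0)=0$. For $h\in\mathcal H^{\rm BV}$, $$\rho_h(X)=\int_0^\infty h(\mathbb P(X>x))\,dx+\int_{-\infty}^0\big(h(\mathbb P(X>x))-h(1)\big)\,dx .$$ Random variables $X_1,\dots,X_n$ are comonotonic if there are increasing (non-strictly) functions $f_i:\mathbb R\to\mathbb R$ and a random variable $Z$ with $X_i=f_i(Z)$ a.s. for all $i\in[n]$. $\mathbb A_n^+(X)$ is the set of comonotonic $(X_1,\dots,X_n)\in(L^\infty)^n$ with $\sum_{i=1}^nX_i=X$. For functionals $\rho_1,\dots,\rho_n$, $\mathop{\boxplus}_{i=1}^n\rho_i(X)=\inf\{\sum_{i=1}^n\rho_i(X_i):(X_1,\dots,X_n)\in\mathbb A_n^+(X)\}$. $(X_1,\dots,X_n)\in\mathbb A_n^+(X)$ is Pareto optimal in $\mathbb A_n^+(X)$ if for any $(Y_1,\dots,Y_n)\in\mathbb A_n^+(X)$ with $\rho_{h_i}(Y_i)\le\rho_{h_i}(X_i)$ for all $i\in[n]$, one has $\rho_{h_i}(Y_i)=\rho_{h_i}(X_i)$ for all $i\in[n]$. *)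

(* Defs.v *)
From HB Require Import structures.
From mathcomp Require Import all_boot all_order all_algebra.
From mathcomp Require Import all_classical all_reals all_analysis.

Set Implicit Arguments.
Unset Strict Implicit.
Unset Printing Implicit Defensive.
Import Order.TTheory GRing.Theory Num.Theory.
Import numFieldNormedType.Exports.

Local Open Scope classical_set_scope.
Local Open Scope ring_scope.

(* Random variables are represented by measurable functions rather than by
   their almost-sure equivalence classes: all identities between random
   variables below are required almost surely only, so that every notion is
   invariant under almost-sure equality. *)

Definition atomless (d : measure_display) (T : measurableType d) (R : realType)
    (P : probability T R) : Prop :=
  forall A : set T, measurable A -> (0 < P A)%E ->
    exists B : set T, [/\ measurable B, B `<=` A & (0 < P B < P A)%E].

Definition Linfty (d : measure_display) (T : measurableType d) (R : realType)
    (P : probability T R) : set {RV P >-> R} :=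
  [set X : {RV P >-> R} | (X : T -> R) \in Lfun P +oo%E].

(* A function on [0, 1] is represented by a function on R; its values outside
   [0, 1] are never used. *)
Definition HBV (R : realType) : set (R -> R) :=
  [set h : R -> R | bounded_variation 0 1 h /\ h 0 = 0].

(* ccdf X x is P(X > x). *)
Definition rho (d : measure_display) (T : measurableType d) (R : realType)
    (P : probability T R) (h : R -> R) (X : {RV P >-> R}) : R :=
  \int[lebesgue_measure]_(x in `[0, +oo[) h (fine (ccdf X x)) +
  \int[lebesgue_measure]_(x in `]-oo, 0]) (h (fine (ccdf X x)) - h 1).

Definition comonotonic (d : measure_display) (T : measurableType d)
    (R : realType) (P : probability T R) (n : nat)
    (X : 'I_n -> {RV P >-> R}) : Prop :=
  exists (f : 'I_n -> R -> R) (Z : {RV P >-> R}),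
    (forall i, {homo f i : x y / x <= y}) /\
    (forall i, {ae P, forall w, X i w = f i (Z w)}).

(* The set A_n^+(X). *)
Definition comonotonic_allocations (d : measure_display)
    (T : measurableType d) (R : realType) (P : probability T R) (n : nat)
    (X : {RV P >-> R}) : set ('I_n -> {RV P >-> R}) :=
  [set Y : 'I_n -> {RV P >-> R} |
    [/\ forall i, Linfty (Y i),
        comonotonic Y &
        {ae P, forall w, \sum_(i < n) Y i w = X w}]].

(* The infimum is taken in the extended reals, so that it is meaningful for
   arbitrary functionals. *)
Definition boxplus (d : measure_display) (T : measurableType d)
    (R : realType) (P : probability T R) (n : nat)
    (r : 'I_n -> {RV P >-> R} -> R) (X : {RV P >-> R}) : \bar R :=
  ereal_inf [set (\sum_(i < n) r i (Y i))%:E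
            | Y in comonotonic_allocations X].

Definition pareto_optimal (d : measure_display) (T : measurableType d)
    (R : realType) (P : probability T R) (n : nat) (h : 'I_n -> R -> R)
    (X : {RV P >-> R}) (Xs : 'I_n -> {RV P >-> R}) : Prop :=
  comonotonic_allocations X Xs /\
  forall Y : 'I_n -> {RV P >-> R}, comonotonic_allocations X Y ->
    (forall i, rho (h i) (Y i) <= rho (h i) (Xs i)) ->
    forall i, rho (h i) (Y i) = rho (h i) (Xs i).

(* Main.v *)
Require Import Defs.
From HB Require Import structures.
From mathcomp Require Import all_boot all_order all_algebra.
From mathcomp Require Import all_classical all_reals all_analysis.
From mathcomp Require Import measurable_realfun ess_sup_inf ring lra.
Import Order.TTheory GRing.Theory Num.Theory.
Import numFieldNormedType.Exports.
Local Open Scope classical_set_scope.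
Local Open Scope ring_scope.

(* Put F = sum_i f_i for a comonotonic allocation X_i = f_i(Z). As
   f_i(y) - f_i(x) <= F(y) - F(x) for x <= y, each f_i factors through F, so that
   X_i = g_i(X) with g_i increasing and 1-Lipschitz. For such g, rho_h(g(X)) is a
   limit of the sums sum_k h(P(X > s_k)) (g(s_{k+1}) - g(s_k)) over partitions
   of the range of X, with an error at most the mesh times the variation of h;
   since these sums are linear in g, rho_h is affine on allocations of X. Hence
   the set of utility vectors (rho_{h_i}(Y_i))_i is convex, and a Pareto optimal
   one is separated from what lies strictly below it by some nonzero
   lambda >= 0. *)

(** * Separation of convex sets from the open negative orthant *)

Section separation.
Set Implicit Arguments.
Unset Strict Implicit.
Context {R : realType}.

Definition convex_family n (A : set ('I_n -> R)) :=
  forall a b t, A a -> A b -> 0 <= t <= 1 ->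
    A (fun i => t * a i + (1 - t) * b i).

(** The second hypothesis keeps [B] off the open negative quadrant. If no point lies left of the
    vertical axis, [(1, 0)] already separates. *)
Lemma separate_plane (B : set (R * R)) :
  (forall p q t, B p -> B q -> 0 <= t <= 1 ->
    B (t * p.1 + (1 - t) * q.1, t * p.2 + (1 - t) * q.2)) ->
  (forall p, B p -> p.1 < 0 -> 0 <= p.2) ->
  exists ab : R * R, [/\ 0 <= ab.1, 0 <= ab.2, ab.1 != 0 \/ ab.2 != 0 &
    forall p, B p -> 0 <= ab.1 * p.1 + ab.2 * p.2].
Proof.
move=> cB B0; have [[p0 [Bp0 p00]]|noneg] := pselect (exists p, B p /\ p.1 < 0);
  last first.
  exists (1, 0); split => //=; first by left; rewrite oner_neq0.
  move=> p Bp; rewrite mul1r mul0r addr0 leNgt; apply/negP => p0.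
  by apply: noneg; exists p.
have Bz p : B p -> p.1 = 0 -> 0 <= p.2.
  move=> Bp pz; rewrite leNgt; apply/negP => p2.
  have p02 := B0 _ Bp0 p00.
  (* With this [t] the mixture of [p0] and [p] has second coordinate [p.2 / 2] and first coordinate
     [t * p0.1], both negative, against [B0]. *)
  pose t := (- p.2) / (2 * (p0.2 - p.2)).
  have d0 : 0 < 2 * (p0.2 - p.2) by lra.
  have t0 : 0 < t by rewrite divr_gt0 //; lra.
  have t1 : t <= 1 by rewrite ler_pdivrMr //; lra.
  have tE : t * (2 * (p0.2 - p.2)) = - p.2 by rewrite mulfVK ?gt_eqF.
  have := B0 _ (cB _ _ t Bp0 Bp _) => /=; rewrite pz (ltW t0) t1 => /(_ isT).
  rewrite mulr0 addr0 pmulr_rlt0 // => /(_ p00); lra.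
(* The slope [inf S] separates: a point right of the axis and one left of it
   span a segment that crosses the axis, where [Bz] applies. *)
pose S := [set p.2 / - p.1 | p in [set p | B p /\ p.1 < 0]].
have S0 : S !=set0 by exists (p0.2 / - p0.1); exists p0.
have S_ge0 : lbound S 0.
  by move=> _ [p [Bp p1] <-]; rewrite divr_ge0 ?oppr_ge0 ?(ltW p1) // B0.
exists (inf S, 1); split => //=.
- exact: lb_le_inf.
- by right; rewrite oner_neq0.
move=> p Bp; rewrite mul1r; have [p1|p1|p1] := ltgtP p.1 0.
- have : inf S <= p.2 / - p.1 by apply: ge_inf; [exists 0|exists p].
  rewrite ler_pdivlMr ?oppr_gt0 //; lra.
- suff : - p.2 / p.1 <= inf S by rewrite ler_pdivrMr //; lra.
  apply: lb_le_inf => // _ [q [Bq q1] <-].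
  have d0 : 0 < p.1 - q.1 by lra.
  pose t := p.1 / (p.1 - q.1).
  have tE : t * (p.1 - q.1) = p.1 by rewrite mulfVK ?gt_eqF.
  have t01 : 0 <= t <= 1.
    by rewrite divr_ge0 ?(ltW p1) ?(ltW d0) //= ler_pdivrMr //; lra.
  have t_first : t * q.1 + (1 - t) * p.1 = 0.
    by transitivity (p.1 - t * (p.1 - q.1)); [ring|rewrite tE subrr].
  have := Bz _ (cB _ _ _ Bq Bp t01) t_first.
  rewrite /= -(pmulr_rge0 _ d0).
  have -> : (p.1 - q.1) * (t * q.2 + (1 - t) * p.2) =
    t * (p.1 - q.1) * q.2 + ((p.1 - q.1) - t * (p.1 - q.1)) * p.2 by ring.
  rewrite tE => H.
  by rewrite ler_pdivlMr ?oppr_gt0 // mulrAC ler_pdivrMr //; lra.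
- by rewrite p1 mulr0 add0r Bz.
Qed.

(** Induction on the dimension, which is a successor because a nonzero normal needs at least one
    coordinate. *)
Lemma separate_orthant n (A : set ('I_n.+1 -> R)) :
  convex_family A ->
  (forall a, A a -> exists i, 0 <= a i) ->
  exists l : 'I_n.+1 -> R, [/\ forall i, 0 <= l i, exists i, l i != 0 &
    forall a, A a -> 0 <= \sum_(i < n.+1) l i * a i].
Proof.
elim: n A => [|n IH] A cA A0.
  exists (fun=> 1); split => //; first by exists ord0; rewrite oner_neq0.
  move=> a Aa; rewrite big_ord1 mul1r.
  by have [i] := A0 _ Aa; rewrite (ord1 i).
(* Separate the points with negative first coordinate in the remaining
   coordinates, and collapse these to one; the plane case then concludes. *)
pose A' := [set (fun i => a (lift ord0 i)) | a in [set a | A a /\ a ord0 < 0]].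
have cA' : convex_family A'.
  move=> _ _ t [a [Aa a0] <-] [b [Ab b0] <-] t01.
  exists (fun i => t * a i + (1 - t) * b i) => //; split; first exact: cA.
  by case/andP: t01 => t0 t1; nra.
have [_ [a [Aa a0] <-]|m [m0 [j mj] mA]] := IH A' cA'.
  have [i] := A0 _ Aa; case: (unliftP ord0 i) => [k ->|->]; first by exists k.
  by rewrite leNgt a0.
pose s (a : 'I_n.+2 -> R) := \sum_(i < n.+1) m i * a (lift ord0 i).
have [_ _ t [a Aa <-] [b Ab <-] t01|_ [a Aa <-] /= a0|[c e] /= [c0 e0 ce0 ceB]] :=
  @separate_plane [set (a ord0, s a) | a in A].
- exists (fun i => t * a i + (1 - t) * b i); first exact: cA.
  congr pair; rewrite /s /= !mulr_sumr -big_split /=.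
  by apply: eq_bigr => i _; ring.
- by apply: mA; exists a.
(* The planar normal [(c, e)] pulled back along the map sending [a] to [(a ord0, s a)]. *)
exists (fun i => if unlift ord0 i is Some k then e * m k else c); split.
- by move=> i; case: unliftP => // k _; rewrite mulr_ge0.
- have [e_eq0|e_neq0] := eqVneq e 0.
    exists ord0; rewrite unlift_none.
    by case: ce0 => //; rewrite e_eq0 eqxx.
  by exists (lift ord0 j); rewrite liftK mulf_neq0.
- move=> a Aa; rewrite big_ord_recl unlift_none.
  under eq_bigr do rewrite liftK -mulrA.
  by rewrite -mulr_sumr; apply: (ceB (a ord0, s a)); exists a.
Qed.

End separation.

(** * Survival functions and almost sure comparison *)

Section distortion_riskmetric.
Set Implicit Arguments.
Unset Strict Implicit.
Context {d : measure_display} {T : measurableType d} {R : realType}.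
Context {P : probability T R}.
Implicit Types (X Y W : {RV P >-> R}) (h v g : R -> R).

Local Notation tail Y x := (fine (ccdf Y x)).

Lemma ae_le_measure (A B : set T) : measurable A -> measurable B ->
  {ae P, forall w, A w -> B w} -> (P A <= P B)%E.
Proof.
move=> mA mB [N [mN PN AB]].
apply: (@le_trans _ _ (P (B `|` N))).
  apply: le_measure; rewrite ?inE //; first exact: measurableU.
  move=> w Aw; have [Bw|nBw] := pselect (B w); first by left.
  by right; apply: AB => /= /(_ Aw).
have -> : P B = (P B + P N)%E by rewrite [P N]PN adde0.
exact: measureU2.
Qed.

Lemma tail_le_ae X Y (x y : R) : {ae P, forall w, x < X w -> y < Y w} ->
  tail X x <= tail Y y.
Proof.
move=> XY; apply: fine_le; rewrite ?fin_num_measure //.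
apply: ae_le_measure.
- by rewrite -[X in measurable X]setTI; exact: measurable_funPT.
- by rewrite -[X in measurable X]setTI; exact: measurable_funPT.
- by apply: filterS XY => w /=; rewrite !in_itv /= !andbT.
Qed.

Lemma tail_nonincreasing Y : {homo (fun x : R => tail Y x) : x y /~ x <= y}.
Proof.
by move=> x y xy; apply/tail_le_ae/nearW => w; exact: le_lt_trans.
Qed.

Lemma tail_ge0 Y (x : R) : 0 <= tail Y x.
Proof. by rewrite fine_ge0. Qed.

Lemma tail_le1 Y (x : R) : tail Y x <= 1.
Proof.
by rewrite -lee_fin fineK ?fin_num_measure // probability_le1.
Qed.

Lemma tail_eq1 Y (x : R) : {ae P, forall w, x < Y w} -> tail Y x = 1.
Proof.
move=> xY; apply/eqP; rewrite eq_le tail_le1 /=.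
rewrite -lee_fin fineK ?fin_num_measure // -(@probability_setT _ _ _ P).
apply: ae_le_measure => //.
- by rewrite -[X in measurable X]setTI; exact: measurable_funPT.
- by apply: filterS xY => w /=; rewrite in_itv /= andbT.
Qed.

Lemma tail_eq0 Y (x : R) : {ae P, forall w, Y w <= x} -> tail Y x = 0.
Proof.
move=> Yx; apply/eqP; rewrite eq_le tail_ge0 andbT.
rewrite -lee_fin fineK ?fin_num_measure // -[leRHS](@measure0 _ _ _ P).
apply: ae_le_measure => //.
- by rewrite -[X in measurable X]setTI; exact: measurable_funPT.
- by apply: filterS Yx => w /=; rewrite in_itv /= andbT ltNge => ->.
Qed.

Lemma Linfty_bounded X : Linfty X ->
  exists2 M : R, 0 <= M & {ae P, forall w, `|X w| <= M}.
Proof.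
case/andP => _; rewrite inE /= /finite_norm unlock /= probability_setT lte01.
have -> : abse \o (EFin \o X) = EFin \o (fun w => `|X w|) by [].
move/ess_supr_bounded => [M XM]; exists `|M|; first exact: normr_ge0.
by apply: filterS XM => w /le_trans; apply; exact: ler_norm.
Qed.

(** Turns approximation errors of order 1/N into exact identities, by the Archimedean property. *)
Lemma eq0_of_le_harmonic (x C : R) :
  (forall N, `|x| <= C / N.+1%:R) -> x = 0.
Proof.
move=> xC; apply/eqP; rewrite -normr_eq0; apply/negPn/negP => x0.
have {}x0 : 0 < `|x| by rewrite lt_def x0 normr_ge0.
have C0 : 0 <= C by have := xC 0%N; rewrite divr1; exact: le_trans.
have := archi_boundP (divr_ge0 C0 (ltW x0)).
set m := Num.Def.archi_bound _ => Cm.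
have := xC m; rewrite ler_pdivlMr // mulrC -ler_pdivlMr // => mC.
have := lt_le_trans (lt_le_trans Cm _) mC.
by rewrite ler_nat leqnSn ltxx => /(_ isT).
Qed.

(* Implied by bounded variation, with [v] the total variation of [h] on [0, x]. *)
Definition controlled h v := forall a b, 0 <= a -> a <= b -> b <= 1 ->
  `|h b - h a| <= v b - v a.

(** Total variation is additive over adjacent intervals, so [v b - v a] is the variation of [h] on
    [a, b], which dominates the increment. *)
Lemma bounded_variation_controlled h : bounded_variation 0 1 h ->
  exists v, controlled h v.
Proof.
move=> bv; exists (fun x => fine (total_variation 0 x h)) => a b a0 ab b1.
have b0 := le_trans a0 ab.
have bvb : bounded_variation 0 b h := bounded_variationl b0 b1 bv.
have fa : total_variation 0 a h \is a fin_num.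
  by apply/(bounded_variationP _ a0)/(bounded_variationl a0 ab).
have fab : total_variation a b h \is a fin_num.
  by apply/(bounded_variationP _ ab)/(bounded_variationr a0 ab).
rewrite (total_variationD h a0 ab) fineD // addrAC subrr add0r.
by rewrite -lee_fin fineK // total_variation_ge.
Qed.

(** * Riemann sums for the distortion riskmetric *)

Section controlled.
Variables (h v : R -> R).
Hypothesis hv : controlled h v.

Lemma controlled_le a b : 0 <= a -> a <= b -> b <= 1 -> v a <= v b.
Proof.
by move=> a0 ab b1; rewrite -subr_ge0 (le_trans _ (hv a0 ab b1)).
Qed.

(** Jordan decomposition: [v] and [v - h] are nondecreasing on [0, 1], so their compositions with
    the nonincreasing tail are monotone, hence measurable. *)
Lemma measurable_controlled_tail Y D : measurable D ->
  measurable_fun D (fun x => h (tail Y x)).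
Proof.
move=> mD.
rewrite (_ : (fun x => _) = (fun x => v (tail Y x)) \-
    (fun x => v (tail Y x) - h (tail Y x))); last first.
  by apply/funext => x /=; ring.
apply: measurable_funB; apply: nonincreasing_measurable => // x y xy.
  apply: controlled_le; [exact: tail_ge0| |exact: tail_le1].
  exact: tail_nonincreasing.
have := hv (tail_ge0 Y y) (tail_nonincreasing Y xy) (tail_le1 Y x).
by rewrite ler_norml => /andP[]; lra.
Qed.

Lemma integrable_controlled_tail Y (a b : R) :
  lebesgue_measure.-integrable `[a, b[%classic
    (EFin \o (fun x => h (tail Y x))).
Proof.
apply: measurable_bounded_integrable => //.
- by rewrite /= lebesgue_measure_itv /=; case: ifP => // _; rewrite -EFinB ltry.
- exact: measurable_controlled_tail.
- exists (`|h 0| + (v 1 - v 0)); split => [|M hM x _ /=]; first exact: num_real.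
  apply/ltW/le_lt_trans/hM.
  have g1 := tail_le1 Y x; have g0 := tail_ge0 Y x.
  have := hv (lexx 0) g0 g1; have := controlled_le g0 g1 (lexx 1).
  have := ler_normD (h 0) (h (tail Y x) - h 0).
  by rewrite addrCA subrr addr0; lra.
Qed.

(* For [x] in [g s, g s'[, the tail of [Y = g(X)] at [x] lies between the tails
   of [X] at [s'] and [s]. *)
Lemma Rintegral_tail_cell X Y g (s s' : R) :
  {homo g : x y / x <= y} -> {ae P, forall w, Y w = g (X w)} -> s <= s' ->
  `|\int[lebesgue_measure]_(x in `[g s, g s'[) h (tail Y x) -
    h (tail X s) * (g s' - g s)| <=
  (v (tail X s) - v (tail X s')) * (g s' - g s).
Proof.
move=> gh YX ss'; have gss' := gh _ _ ss'.
have mE : fine (lebesgue_measure (`[g s, g s'[%classic : set R)) = g s' - g s.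
  rewrite /= lebesgue_measure_itv /= lte_fin; case: ltP => // gs.
  by rewrite (@le_anti _ _ (g s) (g s')) ?subrr // gss'.
have mfin : (lebesgue_measure (`[g s, g s'[%classic : set R) < +oo)%E.
  by rewrite /= lebesgue_measure_itv /=; case: ifP => // _; rewrite -EFinB ltry.
have icst (c : R) : lebesgue_measure.-integrable `[g s, g s'[%classic
    (EFin \o (fun=> c) : R -> \bar R).
  apply: measurable_bounded_integrable => //.
  exists `|c|; split => [|M /ltW cM x _ //]; exact: num_real.
rewrite -mE -!Rintegral_cst // -RintegralB //; last first.
  exact: integrable_controlled_tail.
have ih := integrable_controlled_tail Y (g s) (g s').
have iB : lebesgue_measure.-integrable `[g s, g s'[%classic
  (EFin \o (fun x => h (tail Y x) - h (tail X s))).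
  by have := integrableB _ ih (icst (h (tail X s))); exact.
apply: (le_trans (le_normr_Rintegral _ iB)) => //.
apply: le_Rintegral => //.
  by have := integrable_abse iB; exact.
move=> x /=; rewrite in_itv /= => /andP[gx xg].
have XY : tail X s' <= tail Y x.
  apply: tail_le_ae; apply: filterS YX => w -> s'X.
  exact/(lt_le_trans xg)/gh/ltW.
have YXs : tail Y x <= tail X s.
  apply: tail_le_ae; apply: filterS YX => w -> xX.
  rewrite ltNge; apply/negP => /gh; apply/negP.
  by rewrite -ltNge (le_lt_trans gx).
rewrite distrC (le_trans (hv (tail_ge0 _ _) YXs (tail_le1 _ _))) // lerB //.
by apply: controlled_le => //; [exact: tail_ge0|exact: tail_le1].
Qed.

(** The cell errors add up: each cell has length at most [e] since [g] is 1-Lipschitz, and the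
    differences of [v] along the tail telescope. *)
Lemma Rintegral_tail_partition X Y g (s : nat -> R) (e : R) (n : nat) :
  {homo g : x y / x <= y} -> (forall x y, x <= y -> g y - g x <= y - x) ->
  {ae P, forall w, Y w = g (X w)} ->
  (forall k, s k <= s k.+1) -> (forall k, s k.+1 - s k <= e) ->
  `|\int[lebesgue_measure]_(x in `[g (s 0), g (s n)[) h (tail Y x) -
    \sum_(k < n) h (tail X (s k)) * (g (s k.+1) - g (s k))| <=
  (v (tail X (s 0)) - v (tail X (s n))) * e.
Proof.
move=> gh gL YX s_le s_e; elim: n => [|n IH].
  by rewrite big_ord0 subr0 subrr mul0r set_itvco0 Rintegral_set0 normr0.
have s0n : s 0 <= s n by apply: (homo_leq (@lexx _ R) le_trans s_le).
have tailS : v (tail X (s n.+1)) <= v (tail X (s n)).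
  apply: controlled_le; [exact: tail_ge0| |exact: tail_le1].
  exact: tail_nonincreasing.
have cell := Rintegral_tail_cell gh YX (s_le n).
have cell_e : (v (tail X (s n)) - v (tail X (s n.+1))) *
    (g (s n.+1) - g (s n)) <=
    (v (tail X (s n)) - v (tail X (s n.+1))) * e.
  by rewrite ler_wpM2l ?subr_ge0 // (le_trans (gL _ _ _)).
have itvU : `[g (s 0), g (s n.+1)[%classic =
    `[g (s 0), g (s n)[ `|` `[g (s n), g (s n.+1)[ :> set R.
  by rewrite -itv_bndbnd_setU // bnd_simp gh.
rewrite itvU Rintegral_setU //; first last.
- apply/disj_setPS => x [/=]; rewrite !in_itv /= => /andP[_ xn] /andP[nx _].
  by move: (lt_le_trans xn nx); rewrite ltxx.
- by rewrite -itvU; exact: integrable_controlled_tail.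
rewrite big_ord_recr /=.
set I1 := Rintegral _ _ _ in IH *; set I2 := Rintegral _ _ _ in cell *.
set S := \sum_(k < n) _ in IH *; set c := h _ * _ in cell *.
have -> : I1 + I2 - (S + c) = (I1 - S) + (I2 - c) by ring.
apply: (le_trans (ler_normD _ _)).
apply: (le_trans (lerD IH (le_trans cell cell_e))).
by rewrite -mulrDl addrA subrK.
Qed.

Hypotheses (h0 : h 0 = 0) (h1 : h 1 = 0).

(** The tail is 1 below [a] and 0 from [b] on, and [h] vanishes at both values. As [h 1 = 0], the
    two integrals in [rho] share one integrand and merge. *)
Lemma rho_bounded Y (a b : R) : {ae P, forall w, a <= Y w <= b} ->
  rho h Y = \int[lebesgue_measure]_(x in `[a, b[) h (tail Y x).
Proof.
move=> Yab; set f := fun x => h (tail Y x).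
have f_out : f = f \_ `[a, b[.
  apply/funext => x; rewrite patchE; case: ifPn => //.
  rewrite notin_setE /= in_itv /= => /negP.
  rewrite negb_and -leNgt -ltNge => /orP[xa|bx].
    rewrite /f tail_eq1 //; apply: filterS Yab => w /andP[+ _]; exact: lt_le_trans.
  rewrite /f tail_eq0 //; apply: filterS Yab => w /andP[_ Yb]; exact: le_trans bx.
have fi : lebesgue_measure.-integrable setT (EFin \o f).
  rewrite f_out -restrict_EFin; apply: (integrable_mkcond _ _).1 => //.
  exact: integrable_controlled_tail.
have fiD (D : set R) : measurable D ->
  lebesgue_measure.-integrable D (EFin \o f).
  by move=> mD; apply: integrableS fi.
rewrite /rho h1; under [X in _ + X]eq_Rintegral do rewrite subr0.
(* Both domains contain 0; removing this null point from the second makes them disjoint. *)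
rewrite -/f -Rintegral_itv_bndo_bndc; last exact: fiD.
rewrite addrC -Rintegral_setU //; first last.
- apply/disj_setPS => x [/=]; rewrite !in_itv /= andbT => x0 x0'.
  by move: (lt_le_trans x0 x0'); rewrite ltxx.
- by apply: fiD; exact: measurableU.
rewrite -itv_bndbnd_setU // set_itvNyy.
by rewrite [RHS]Rintegral_mkcond -f_out.
Qed.

(* The point: this sum is linear in [g]. *)
Definition riemann_rho X g (M : R) (N : nat) : R :=
  let s k := - M + k%:R * (2 * M / N.+1%:R) in
  \sum_(k < N.+1) h (tail X (s k)) * (g (s k.+1) - g (s k)).

(** [Y] takes its values in [g(-M), g(M)], and the uniform partition of [-M, M] has mesh
    [2 * M / N.+1%:R]; the drop of [v] along the tail is at most [v 1 - v 0]. *)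
Lemma rho_approx X Y g (M : R) (N : nat) : 0 <= M ->
  {ae P, forall w, `|X w| <= M} ->
  {homo g : x y / x <= y} -> (forall x y, x <= y -> g y - g x <= y - x) ->
  {ae P, forall w, Y w = g (X w)} ->
  `|rho h Y - riemann_rho X g M N| <= (v 1 - v 0) * (2 * M) / N.+1%:R.
Proof.
move=> M0 XM gh gL YX.
have N0 : N.+1%:R != 0 :> R by rewrite pnatr_eq0.
pose s k : R := - M + k%:R * (2 * M / N.+1%:R).
have s0E : s 0%N = - M by rewrite /s mul0r addr0.
have sNE : s N.+1 = M by rewrite /s mulrC divfK //; ring.
have sS k : s k.+1 - s k = 2 * M / N.+1%:R by rewrite /s -natr1; ring.
have e0 : 0 <= 2 * M / N.+1%:R by rewrite divr_ge0 ?mulr_ge0.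
have s_le k : s k <= s k.+1 by rewrite -subr_ge0 sS.
have s_e k : s k.+1 - s k <= 2 * M / N.+1%:R by rewrite sS.
have Yb : {ae P, forall w, g (s 0%N) <= Y w <= g (s N.+1)}.
  apply: filterS2 XM YX => w; rewrite ler_norml s0E sNE => /andP[X1 X2] ->.
  by rewrite !gh.
rewrite (rho_bounded Yb).
apply: (le_trans (Rintegral_tail_partition N.+1 gh gL YX s_le s_e)).
rewrite -[leRHS]mulrA ler_wpM2r //.
have := controlled_le (tail_ge0 X (s N.+1)) (tail_le1 X (s N.+1)) (lexx 1).
have := controlled_le (lexx 0) (tail_ge0 X (s N.+1)) (tail_le1 X (s N.+1)).
have := controlled_le (tail_ge0 X (s 0%N)) (tail_le1 X (s 0%N)) (lexx 1).
lra.
Qed.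

Lemma rho_combination X Y Y' W g g' (t : R) : Linfty X ->
  0 <= t <= 1 ->
  {homo g : x y / x <= y} -> (forall x y, x <= y -> g y - g x <= y - x) ->
  {homo g' : x y / x <= y} -> (forall x y, x <= y -> g' y - g' x <= y - x) ->
  {ae P, forall w, Y w = g (X w)} -> {ae P, forall w, Y' w = g' (X w)} ->
  {ae P, forall w, W w = t * Y w + (1 - t) * Y' w} ->
  rho h W = t * rho h Y + (1 - t) * rho h Y'.
Proof.
move=> /Linfty_bounded[M M0 XM] /andP[t0 t1] gh gL gh' gL' YX YX' WE.
have t1' : 0 <= 1 - t by rewrite subr_ge0.
(* [G] is again increasing and 1-Lipschitz, so the same partition approximates [rho] at [W], [Y] and
   [Y']. *)
pose G x := t * g x + (1 - t) * g' x.
have Gh : {homo G : x y / x <= y}.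
  by move=> x y xy; rewrite lerD // ler_wpM2l // ?gh ?gh'.
have GL x y : x <= y -> G y - G x <= y - x.
  move=> xy; rewrite (_ : G y - G x = t * (g y - g x) + (1 - t) * (g' y - g' x));
    last by rewrite /G; ring.
  rewrite (_ : y - x = t * (y - x) + (1 - t) * (y - x)); last by ring.
  by rewrite lerD // ler_wpM2l // ?gL ?gL'.
have WX : {ae P, forall w, W w = G (X w)}.
  by apply: filterS3 YX YX' WE => w -> ->.
apply/eqP; rewrite -subr_eq0; apply/eqP.
(* The factor 2 counts one error bound for [W] and one for the weighted errors of [Y] and [Y'],
   whose weights sum to 1. *)
apply: (@eq0_of_le_harmonic _ (2 * ((v 1 - v 0) * (2 * M)))) => N.
have RG : riemann_rho X G M N =
    t * riemann_rho X g M N + (1 - t) * riemann_rho X g' M N.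
  rewrite /riemann_rho !mulr_sumr -big_split /=.
  by apply: eq_bigr => k _; rewrite /G; ring.
have := rho_approx N M0 XM Gh GL WX.
have := rho_approx N M0 XM gh gL YX.
have := rho_approx N M0 XM gh' gL' YX'.
rewrite RG -(mulrA 2); set B := _ * _ / _.
set r := riemann_rho X g M N; set r' := riemann_rho X g' M N.
rewrite !ler_norml => /andP[A1 A2] /andP[B1 B2] /andP[C1 C2].
have H1 := ler_wpM2l t0 B1; have H2 := ler_wpM2l t0 B2.
have H3 := ler_wpM2l t1' A1; have H4 := ler_wpM2l t1' A2.
apply/andP; split; lra.
Qed.

End controlled.
End distortion_riskmetric.

(** * Comonotonic allocations as Lipschitz functions of the total *)

Section comonotonic_allocations.
Set Implicit Arguments.
Unset Strict Implicit.
Context {d : measure_display} {T : measurableType d} {R : realType}.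
Context {P : probability T R}.
Implicit Types X : {RV P >-> R}.

(* [g] is the monotone McShane extension
   [g x = inf_z (phi z + max 0 (x - F z))]. *)
Lemma lipschitz_factor (phi F : R -> R) : {homo phi : x y / x <= y} ->
  (forall x y, x <= y -> phi y - phi x <= F y - F x) ->
  exists g : R -> R, [/\ {homo g : x y / x <= y},
    forall x y, x <= y -> g y - g x <= y - x & forall z, phi z = g (F z)].
Proof.
move=> phiH phiL.
(* At [x = F z0] no term of the infimum is below [phi z0]: by monotonicity of [phi] when [z0 <= z],
   by the increment bound otherwise. The term [z = z0] attains this value. *)
have key z z0 : phi z0 <= phi z + Num.max 0 (F z0 - F z).
  rewrite -lerBlDl le_max; case: (leP z0 z) => [/phiH|/ltW/phiL ->].
    by rewrite -subr_le0 => ->.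
  by rewrite orbT.
pose S x := [set phi z + Num.max 0 (x - F z) | z in setT].
have S0 x : S x !=set0 by exists (phi 0 + Num.max 0 (x - F 0)); exists 0.
have Slb x : has_lbound (S x).
  (* By [key], the terms at [F 0] are at least [phi 0], and passing from [F 0] to [x] lowers a term
     by at most the distance. *)
  exists (phi 0 - `|x - F 0|) => _ [z _ <-].
  rewrite lerBlDr (le_trans (key z 0)) // -addrA lerD2l.
  have := ler_norm (- (x - F 0)); rewrite normrN => xF.
  rewrite ge_max addr_ge0 ?le_max ?lexx //=.
  by rewrite addr_maxl le_max; apply/orP; right; lra.
have inf_le x z : inf (S x) <= phi z + Num.max 0 (x - F z).
  by apply: ge_inf => //; exists z.
exists (fun x => inf (S x)); split.
- move=> x y xy; apply: lb_le_inf => // _ [z _ <-].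
  apply: (le_trans (inf_le x z)); rewrite lerD2l ge_max !le_max lexx /=.
  by apply/orP; right; rewrite lerD2r.
- move=> x y xy; rewrite lerBlDr -lerBlDl; apply: lb_le_inf => // _ [z _ <-].
  rewrite lerBlDl; apply: (le_trans (inf_le y z)).
  rewrite addrCA lerD2l ge_max; apply/andP; split.
    by rewrite addr_ge0 ?subr_ge0 // le_max lexx.
  by rewrite -lerBlDl le_max; apply/orP; right; lra.
- move=> z; apply: le_anti; apply/andP; split.
    by apply: lb_le_inf => // _ [z' _ <-]; exact: key.
  by rewrite (le_trans (inf_le _ z)) // subrr maxxx addr0.
Qed.

(** Replaces the variable [Z], which differs between allocations, by the common [X]: almost surely
    [F(Z) = X], so factoring [f i] through [F] factors [Y i] through [X]. *)
Lemma comonotonic_allocation_factor n X (Y : 'I_n -> {RV P >-> R}) :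
  comonotonic_allocations X Y ->
  exists g : 'I_n -> R -> R, forall i, [/\ {homo g i : x y / x <= y},
    forall x y, x <= y -> g i y - g i x <= y - x &
    {ae P, forall w, Y i w = g i (X w)}].
Proof.
case=> _ [f [Z [fh YZ]]] YX.
pose F x := \sum_(i < n) f i x.
suff H i : exists gi : R -> R, [/\ {homo gi : x y / x <= y},
    forall x y, x <= y -> gi y - gi x <= y - x &
    {ae P, forall w, Y i w = gi (X w)}] by have [g gP] := choice H; exists g.
have [|gi [gh gL gE]] := @lipschitz_factor (f i) F (fh i).
  move=> x y xy; rewrite /F -sumrB (bigD1 i) //= lerDl.
  by apply: sumr_ge0 => j _; rewrite subr_ge0 fh.
exists gi; split => //.
have YZall : {ae P, forall w, forall j, Y j w = f j (Z w)}.
  exact: filter_forall.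
apply: filterS2 YZall YX => w Yw <-; rewrite Yw gE /F.
by under eq_bigr do rewrite -Yw.
Qed.

(** Both allocations are increasing functions of the same [X], hence so is the mixture; comonotonic
    vectors driven by different variables can have mixtures that are not comonotonic. *)
Lemma comonotonic_allocations_convex n X (Y Y' : 'I_n -> {RV P >-> R}) (t : R) :
  0 <= t <= 1 ->
  comonotonic_allocations X Y -> comonotonic_allocations X Y' ->
  comonotonic_allocations X
    (fun i => t *: Y i + (1 - t) *: Y' i : {RV P >-> R}).
Proof.
move=> /andP[t0 t1] AY AY'.
have [g gP] := comonotonic_allocation_factor AY.
have [g' gP'] := comonotonic_allocation_factor AY'.
have [LY _ YX] := AY; have [LY' _ YX'] := AY'.
split.
- move=> i; have [L0 LD] := @Lfun_submod_closed _ T R P +oo%E (leey _).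
  have := LD (1 - t) _ _ (LY' i) L0; rewrite addr0; exact: LD (LY i).
- exists (fun i x => t * g i x + (1 - t) * g' i x), X; split=> i.
    have [gh _ _] := gP i; have [gh' _ _] := gP' i.
    by move=> x y xy; rewrite lerD // ler_wpM2l ?subr_ge0 // ?gh ?gh'.
  have [_ _ YE] := gP i; have [_ _ YE'] := gP' i.
  by apply: filterS2 YE YE' => w /= <- <-.
- apply: filterS2 YX YX' => w Yw Yw'.
  transitivity (t * \sum_(i < n) Y i w + (1 - t) * \sum_(i < n) Y' i w).
    by rewrite !mulr_sumr -big_split.
  by rewrite Yw Yw' -mulrDl addrC subrK mul1r.
Qed.

Lemma rho_convex n X (Y Y' : 'I_n -> {RV P >-> R}) (t : R) (h : R -> R) i :
  Linfty X -> HBV h -> h 1 = 0 -> 0 <= t <= 1 ->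
  comonotonic_allocations X Y -> comonotonic_allocations X Y' ->
  rho h (t *: Y i + (1 - t) *: Y' i : {RV P >-> R}) =
    t * rho h (Y i) + (1 - t) * rho h (Y' i).
Proof.
move=> LX [bv h0] h1 t01 /comonotonic_allocation_factor[g gP].
move=> /comonotonic_allocation_factor[g' gP'].
have [v hv] := bounded_variation_controlled bv.
have [gh gL YE] := gP i; have [gh' gL' YE'] := gP' i.
apply: (rho_combination hv h0 h1 LX t01 gh gL gh' gL' YE YE').
exact: nearW.
Qed.

End comonotonic_allocations.

(** * Pareto optimality and minimization of weighted sums *)

Theorem proposition7 (d : measure_display) (T : measurableType d)
    (R : realType) (P : probability T R) (hP : atomless P)
    (n : nat) (hn : (1 <= n)%N)
    (X : {RV P >-> R}) (hX : Linfty X)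
    (h : 'I_n -> R -> R) (hh : forall i, HBV (h i)) (hh1 : forall i, h i 1 = 0)
    (Xs : 'I_n -> {RV P >-> R}) (hXs : comonotonic_allocations X Xs) :
  ((exists lambda : 'I_n -> R,
      (forall i, 0 < lambda i) /\
      (\sum_(i < n) lambda i * rho (h i) (Xs i))%:E =
        boxplus (fun i Y => lambda i * rho (h i) Y) X) ->
    pareto_optimal h X Xs) /\
  (pareto_optimal h X Xs ->
    exists lambda : 'I_n -> R,
      [/\ forall i, 0 <= lambda i,
          exists i, lambda i != 0 &
          (\sum_(i < n) lambda i * rho (h i) (Xs i))%:E =
            boxplus (fun i Y => lambda i * rho (h i) Y) X]).
Proof.
(* Since [Xs] is itself an allocation, reaching the infimum means minimizing the weighted sum among
   allocations. *)
have attained lambda :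
    (\sum_(i < n) lambda i * rho (h i) (Xs i))%:E =
      boxplus (fun i Y => lambda i * rho (h i) Y) X <->
    forall Y : 'I_n -> {RV P >-> R}, comonotonic_allocations X Y ->
      \sum_(i < n) lambda i * rho (h i) (Xs i) <=
      \sum_(i < n) lambda i * rho (h i) (Y i).
  split=> [E Y AY|H].
    by rewrite -lee_fin E; apply: ereal_inf_lbound; exists Y.
  apply/eqP; rewrite eq_le; apply/andP; split.
    by apply: le_ereal_inf_tmp => _ [Y AY <-]; rewrite lee_fin; exact: H.
  by apply: ereal_inf_lbound; exists Xs.
split=> [[lambda [lambda0 /attained H]]|[_ pareto]].
  (* With all weights positive, a strict improvement in coordinate [i] and no loss elsewhere would
     strictly lower the weighted sum. *)
  split=> // Y AY YX i; apply: le_anti; rewrite YX /= leNgt; apply/negP => YXi.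
  have := H _ AY; rewrite leNgt => /negP; apply.
  rewrite (bigD1 i) //= [ltRHS](bigD1 i) //= ltr_leD ?ltr_pM2l //.
  by apply: ler_sum => j _; rewrite ler_pM2l.
case: n hn h hh hh1 Xs hXs pareto attained => // n _ h hh hh1 Xs hXs.
move=> pareto attained.
(* Utility vectors translated so that [Xs] sits at the origin; [A] is convex as [rho] is affine
   along mixtures of allocations. *)
pose A := [set (fun i => rho (h i) (Y i) - rho (h i) (Xs i)) |
  Y in @comonotonic_allocations _ _ _ P n.+1 X].
have cA : convex_family A.
  move=> _ _ t [Y AY <-] [Y' AY' <-] t01.
  exists (fun i => t *: Y i + (1 - t) *: Y' i : {RV P >-> R}).
    exact: comonotonic_allocations_convex.
  apply/funext => i; rewrite (rho_convex i hX (hh i) (hh1 i) t01 AY AY'); ring.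
(* A vector with all coordinates negative would improve every agent strictly, while Pareto
   optimality turns these inequalities into equalities. *)
have A0 a : A a -> exists i, 0 <= a i.
  move=> [Y AY <-]; apply: contrapT => noneg.
  have YX i : rho (h i) (Y i) < rho (h i) (Xs i).
    by rewrite -subr_lt0 ltNge; apply/negP => ?; apply: noneg; exists i.
  have := YX ord0; rewrite (pareto _ AY) ?ltxx // => i; exact: ltW.
have [lambda [lambda0 lambdaN0 lambdaA]] := separate_orthant cA A0.
exists lambda; split => //; apply/attained => Y AY.
rewrite -subr_ge0 -sumrB; under eq_bigr do rewrite -mulrBr.
by apply: lambdaA; exists Y.
Qed.
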